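(* Let $k\ge2$. For any two elements $\varphi,\psi\in M_{k,1}$ such that $\varphi>_{\mathcal R}\psi$ there exists $\chi\in M_{k,1}$ such that $\varphi>_{\mathcal R}\chi>_{\mathcal R}\psi$.
   Context: $A$ is an alphabet with $k\ge2$ letters, $A^*$ the free monoid over $A$. A right ideal of $A^*$ is a set $R\subseteq A^*$ with $RA^*\subseteq R$. A right ideal homomorphism is a function $\varphi$ whose domain ${\sf Dom}(\varphi)\subseteq A^*$ is a right ideal, with values in $A^*$ and $\varphi(xw)=\varphi(x)w$ for all $x\in{\sf Dom}(\varphi)$, $w\in A^*$. ${\sf riHom}(A^* )$ is the set of right ideal homomorphisms with finitely generated domain. A right ideal $R'\subseteq R$ is essential in the right ideal $R$ iff $R'$ intersects every nonempty right ideal contained in $R$. $\Phi$ is an essentially equal restriction of $\varphi$ (and $\varphi$ an essentially equal extension of $\Phi$) iff $\Phi$ is a restriction of $\varphi$ and ${\sf Dom}(\Phi)$ is essential in ${\sf Dom}(\varphi)$. Every $\varphi\in{\sf riHom}(A^* )$ has a unique maximal essentially equal extension $\max(\varphi)$. The Thompson-Higman monoid is $M_{k,1}=\{\max(\varphi):\varphi\in{\sf riHom}(A^* )\}$ with multiplication $\psi\varphi=\max(\psi\circ\varphi)$ (functions act on the left). $u\le_{\mathcal R}v$ means $u=vx$ for some $x\in M_{k,1}$; $u\equiv_{\mathcal R}v$ means $u\le_{\mathcal R}v$ and $v\le_{\mathcal R}u$; $v>_{\mathcal R}u$ means $u\le_{\mathcal R}v$ and not $u\equiv_{\mathcal R}v$.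 *)

(* Defs.v *)
From mathcomp Require Import all_boot.
From mathcomp Require Import boolp classical_sets.

Set Implicit Arguments.
Unset Strict Implicit.
Unset Printing Implicit Defensive.

Local Open Scope classical_set_scope.

Definition right_ideal (A : finType) (R : set (seq A)) : Prop :=
  forall x w, R x -> R (x ++ w).

Definition fin_gen (A : finType) (R : set (seq A)) : Prop :=
  exists C : seq (seq A), R = [set x | exists2 c, c \in C & exists w, x = c ++ w].

Definition essential (A : finType) (R' R : set (seq A)) : Prop :=
  R' `<=` R /\
  forall S, right_ideal S -> S !=set0 -> S `<=` R -> R' `&` S !=set0.

(* A partial function on words is a function to [option]; [None] means
   undefined. The empty function (the zero of the monoid) is allowed. *)
Definition dom (A : finType) (f : seq A -> option (seq A)) : set (seq A) :=
  [set x | exists y, f x = Some y].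

Definition ri_hom (A : finType) (f : seq A -> option (seq A)) : Prop :=
  right_ideal (dom f) /\
  forall x y w, f x = Some y -> f (x ++ w) = Some (y ++ w).

Record riHom (A : finType) : Type := RiHom {
  ri_fun :> seq A -> option (seq A);
  ri_homP : ri_hom ri_fun;
  ri_fin_gen : fin_gen (dom ri_fun)
}.

Definition restriction (A : finType) (Phi phi : riHom A) : Prop :=
  forall x y, Phi x = Some y -> phi x = Some y.

Definition ess_eq_restriction (A : finType) (Phi phi : riHom A) : Prop :=
  restriction Phi phi /\ essential (dom Phi) (dom phi).

Definition is_max_ext (A : finType) (phi Phi : riHom A) : Prop :=
  ess_eq_restriction phi Phi /\
  forall Psi, ess_eq_restriction phi Psi -> restriction Phi Psi -> Psi = Phi.

Lemma riHom_ext (A : finType) (f g : riHom A) : f =1 g -> f = g.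
Proof.
case: f g => [f f1 f2] [g g1 g2] /= /funext fg; subst g.
by rewrite (Prop_irrelevance f1 g1) (Prop_irrelevance f2 g2).
Qed.

Lemma fin_gen_cover (A : finType) (D : set (seq A)) (C : seq (seq A)) :
  right_ideal D ->
  (forall x, D x -> exists2 c, c \in C & D c /\ exists w, x = c ++ w) ->
  fin_gen D.
Proof.
move=> Did DC; exists [seq c <- C | `[< D c >]]; apply/seteqP; split=> x /=.
  move=> /DC[c cC [Dc xc]]; exists c => //; rewrite mem_filter cC andbT.
  exact/asboolP.
by case=> c; rewrite mem_filter => /andP[/asboolP Dc _] [w ->]; apply: Did.
Qed.

Lemma cat_comparable (A : finType) (x v p w : seq A) : x ++ v = p ++ w ->
  (exists u, x = p ++ u) \/ (exists u, p = x ++ u).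
Proof.
elim: x p => [|a x IH] [|b p] /=.
- by left; exists [::].
- by right; exists (b :: p).
- by left; exists (a :: x).
case=> -> /IH[[u ->]|[u ->]]; [left | right]; by exists u.
Qed.

Lemma catIr (A : finType) (x y v : seq A) : x ++ v = y ++ v -> x = y.
Proof.
move=> e; have s : size x = size y.
  by have /eqP := congr1 size e; rewrite !size_cat eqn_add2r => /eqP.
by have /eqP := e; rewrite eqseq_cat // => /andP[/eqP].
Qed.

Lemma max_ext_exists_unique (A : finType) (phi : riHom A) :
  exists! Phi : riHom A, is_max_ext phi Phi.
Proof.
pose U x y := exists Psi : riHom A,
  ess_eq_restriction phi Psi /\ Psi x = Some y.
have ess_meet (D : set (seq A)) x : right_ideal D -> essential (dom phi) D ->
    D x -> exists v y, phi (x ++ v) = Some y.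
  move=> Did [_ ess] Dx.
  have [|||z [[y e] [v zv]]] := ess [set z | exists v, z = x ++ v].
  - by move=> _ w [v ->]; exists (v ++ w); rewrite catA.
  - by exists x, [::]; rewrite cats0.
  - by move=> _ [v ->]; apply: Did.
  by exists v, y; rewrite -zv.
have Umeet x y : U x y -> exists v y', phi (x ++ v) = Some y'.
  move=> [Psi [[_ ess] Pxy]].
  by apply: (ess_meet _ _ (ri_homP Psi).1 ess); exists y.
have Ufun x y y' : U x y -> U x y' -> y = y'.
  move=> Uxy; have [v [z pz]] := Umeet _ _ Uxy; move: Uxy.
  move=> [P [[rP _] Pxy]] [P' [[rP' _] Pxy']].
  have := rP _ _ pz; rewrite ((ri_homP P).2 _ _ v Pxy).
  have := rP' _ _ pz; rewrite ((ri_homP P').2 _ _ v Pxy').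
  by move=> -[<-] [] /catIr.
have Ucat x y w : U x y -> U (x ++ w) (y ++ w).
  by move=> [P [eP Px]]; exists P; split => //; apply: (ri_homP P).2.
pose g x := if pselect (exists y, U x y) is left e then Some (projT1 (cid e))
            else None.
have gP x y : g x = Some y <-> U x y.
  rewrite /g; case: pselect => [e|ne]; last first.
    by split=> // Uxy; case: ne; exists y.
  case: cid => z Uz /=; split=> [[<-]//|Uxy].
  by congr Some; apply: Ufun Uz Uxy.
have hg : ri_hom g.
  split=> [x w [y /gP Uxy]|x y w /gP Uxy]; last exact/gP/Ucat.
  by exists (y ++ w); exact/gP/Ucat.
have fg : fin_gen (dom g).
  have [C domC] := ri_fin_gen phi.
  apply: (@fin_gen_cover _ _ [seq take i c | c <- C, i <- iota 0 (size c).+1]).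
    exact: hg.1.
  move=> x dgx; have [y /gP Uxy] := dgx; have [v [z pz]] := Umeet _ _ Uxy.
  have : dom phi (x ++ v) by exists z.
  rewrite {1}domC => -[c cC [w /cat_comparable[[u xcu]|[u cxu]]]].
    exists c.
      apply/allpairsPdep; exists c, (size c).
      by rewrite mem_iota add0n ltnSn take_size.
    split; last by exists u.
    have : dom phi c by rewrite domC; exists c => //; exists [::]; rewrite cats0.
    case=> t pt; exists t; apply/gP; case: Uxy => P [eP _].
    by exists P; split=> //; apply: eP.1.
  exists x; last by split => //; exists [::]; rewrite cats0.
  apply/allpairsPdep; exists c, (size x).
  by rewrite mem_iota add0n ltnS cxu size_cat leq_addr take_size_cat -?cxu.
pose G := RiHom hg fg.
have phiU x y : phi x = Some y -> U x y.
  move=> e; exists phi; split=> //; split=> //; split=> // S _ [s Ss] sub.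
  by exists s; split=> //; apply: sub.
have eG : ess_eq_restriction phi G.
  split=> [x y /phiU Uxy|]; first exact/gP.
  split=> [x [y /phiU Uxy]|S Sid [s Ss] sub]; first by exists y; exact/gP.
  have [y /gP Usy] := sub _ Ss; have [v [z pz]] := Umeet _ _ Usy.
  by exists (s ++ v); split; [exists z | apply: Sid].
have leG P : ess_eq_restriction phi P -> restriction P G.
  by move=> eP x y e; apply/gP; exists P.
have anti (P Q : riHom A) : restriction P Q -> restriction Q P -> P = Q.
  move=> PQ QP; apply: riHom_ext => x.
  case Px: (P x) => [y|]; first by rewrite (PQ _ _ Px).
  by case Qx: (Q x) => [y|//]; rewrite -Px (QP _ _ Qx).
exists G; split=> [|P [eP maxP]]; last by apply: maxP => //; apply: leG.
by split=> // P eP GP; apply: anti => //; apply: leG.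
Qed.

Definition maxext (A : finType) (phi : riHom A) : riHom A :=
  projT1 (cid (max_ext_exists_unique phi)).

Lemma maxextP (A : finType) (phi : riHom A) : is_max_ext phi (maxext phi).
Proof. by rewrite /maxext; case: cid => P []. Qed.

Definition comp_fun (A : finType) (psi phi : seq A -> option (seq A)) :
  seq A -> option (seq A) := fun x => obind psi (phi x).

Lemma comp_ri_hom (A : finType) (psi phi : riHom A) : ri_hom (comp_fun psi phi).
Proof.
have H x y w : comp_fun psi phi x = Some y ->
    comp_fun psi phi (x ++ w) = Some (y ++ w).
  rewrite /comp_fun; case e: (phi x) => [z|//] /= ez.
  by rewrite ((ri_homP phi).2 _ _ w e) /= ((ri_homP psi).2 _ _ w ez).
by split=> // x w [y /H e]; exists (y ++ w).
Qed.

Lemma comp_fin_gen (A : finType) (psi phi : riHom A) :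
  fin_gen (dom (comp_fun psi phi)).
Proof.
have [P domP] := ri_fin_gen phi; have [Q domQ] := ri_fin_gen psi.
pose ext p q := p ++ drop (size (odflt [::] (phi p))) q.
apply: (@fin_gen_cover _ _ (P ++ [seq ext p q | p <- P, q <- Q])).
  exact: (comp_ri_hom psi phi).1.
move=> x [y]; rewrite /comp_fun; case e: (phi x) => [z|//] /= ez.
have : dom phi x by exists z.
rewrite domP => -[p pP [w xpw]].
have : dom phi p by rewrite domP; exists p => //; exists [::]; rewrite cats0.
move=> [t pt]; move: e; rewrite xpw ((ri_homP phi).2 _ _ w pt) => -[tw].
have : dom psi z by exists y.
rewrite domQ => -[q qQ [v zqv]].
have [r qr] : dom psi q.
  by rewrite domQ; exists q => //; exists [::]; rewrite cats0.
have := tw; rewrite zqv => tqv; have [[u tqu]|[u qtu]] := cat_comparable tqv.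
  exists p; first by rewrite mem_cat pP.
  split; last by exists w.
  exists (r ++ u); rewrite /comp_fun pt /= tqu.
  exact: (ri_homP psi).2.
exists (ext p q).
  by rewrite mem_cat; apply/orP; right; apply/allpairsP; exists (p, q).
rewrite /ext pt /= qtu drop_size_cat //; split.
  by exists r; rewrite /comp_fun ((ri_homP phi).2 _ _ u pt) /= -qtu.
exists v; rewrite -catA; congr (_ ++ _).
by move: tqv; rewrite qtu -catA => /eqP; rewrite eqseq_cat // => /andP[_ /eqP].
Qed.

(* Functions act on the left: [comp psi phi] applies [phi] first. *)
Definition comp (A : finType) (psi phi : riHom A) : riHom A :=
  RiHom (comp_ri_hom psi phi) (comp_fin_gen psi phi).

(* The Thompson-Higman monoid M_{k,1}, where k = #|A|. *)
Definition TH_monoid (A : finType) : Type :=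
  {m : riHom A | exists phi, m = maxext phi}.

Definition TH_max (A : finType) (phi : riHom A) : TH_monoid A :=
  exist _ (maxext phi) (ex_intro _ phi erefl).

Definition TH_mul (A : finType) (psi phi : TH_monoid A) : TH_monoid A :=
  TH_max (comp (sval psi) (sval phi)).

Definition R_le (A : finType) (u v : TH_monoid A) : Prop :=
  exists x : TH_monoid A, u = TH_mul v x.

Definition R_equiv (A : finType) (u v : TH_monoid A) : Prop :=
  R_le u v /\ R_le v u.

Definition R_gt (A : finType) (v u : TH_monoid A) : Prop :=
  R_le u v /\ ~ R_equiv u v.

(* Main.v *)
Require Import Defs.
From mathcomp Require Import all_boot.
From mathcomp Require Import boolp classical_sets.

(** The R-preorder only sees images: [u <=_R v] iff every word of [Im u] has an
    extension in [Im v]. So if [v >_R u], some [y] in [Im v] has no extension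
    in [Im u]. For distinct letters [a], [b], the identity restricted to
    [Im u \cup y a A^*] lies strictly in between: [y a] separates it from [u],
    and [y b] separates [v] from it. *)

Set Implicit Arguments.
Unset Strict Implicit.
Unset Printing Implicit Defensive.

Local Open Scope classical_set_scope.

Section RightIdealHomomorphisms.
Variable A : finType.
Implicit Types (f g h : riHom A) (R : set (seq A)) (x y z w : seq A).

Definition im f : set (seq A) := [set y | exists x, f x = Some y].

Lemma ri_cat f x y w : f x = Some y -> f (x ++ w) = Some (y ++ w).
Proof. exact: (ri_homP f).2. Qed.

Lemma right_ideal_im f : right_ideal (im f).
Proof. by move=> y w [x fx]; exists (x ++ w); apply: ri_cat. Qed.

Lemma fin_gen_im f : fin_gen (im f).
Proof.
have [C domC] := ri_fin_gen f.
apply: (@fin_gen_cover _ _ [seq odflt [::] (f c) | c <- C]).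
  exact: right_ideal_im.
move=> y [x fx]; have : dom f x by exists y.
rewrite domC => -[c cC [w xcw]].
have [t ft] : dom f c by rewrite domC; exists c => //; exists [::]; rewrite cats0.
exists t; first by apply/mapP; exists c; rewrite ?ft.
split; first by exists c.
by exists w; move: fx; rewrite xcw (ri_cat w ft) => -[].
Qed.

Lemma fin_gen_setU R R' : fin_gen R -> fin_gen R' -> fin_gen (R `|` R').
Proof.
move=> [C ->] [C' ->]; exists (C ++ C'); apply/seteqP; split=> x /=.
  by case=> -[c cC xc]; exists c; rewrite // mem_cat cC ?orbT.
by case=> c; rewrite mem_cat => /orP[] cC xc; [left|right]; exists c.
Qed.

Definition id_fun R x := if `[< R x >] then Some x else None.

Lemma id_funP R x y : id_fun R x = Some y <-> R x /\ y = x.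
Proof.
rewrite /id_fun; case: asboolP => Rx; last by split=> [|[]].
by split=> [[]|[_ ->]].
Qed.

Lemma dom_id_fun R : dom (id_fun R) = R.
Proof.
apply/seteqP; split=> x; first by case=> y /id_funP[].
by move=> Rx; exists x; apply/id_funP.
Qed.

Lemma id_fun_ri_hom R : right_ideal R -> ri_hom (id_fun R).
Proof.
move=> Rid; split; first by rewrite dom_id_fun.
by move=> x y w /id_funP[Rx ->]; apply/id_funP; split=> //; apply: Rid.
Qed.

Lemma id_fun_fin_gen R : fin_gen R -> fin_gen (dom (id_fun R)).
Proof. by rewrite dom_id_fun. Qed.

Definition id_on R (Rid : right_ideal R) (Rfg : fin_gen R) : riHom A :=
  RiHom (id_fun_ri_hom Rid) (id_fun_fin_gen Rfg).

Lemma compP f g x z :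
  Defs.comp f g x = Some z <-> exists2 y, g x = Some y & f y = Some z.
Proof.
rewrite /= /comp_fun; case: (g x) => [y|] /=; last by split=> // -[].
by split=> [fy|[_ [<-]]//]; exists y.
Qed.

(** The preorder in which [f] agrees with [g] on an essential part of [dom f]. Neither map need
    restrict the other. *)
Definition ess_le f g :=
  forall x y, f x = Some y -> exists w, g (x ++ w) = Some (y ++ w).

Lemma restriction_ess_le f g : restriction f g -> ess_le f g.
Proof. by move=> fg x y /fg gx; exists [::]; rewrite !cats0. Qed.

Lemma ess_le_trans f g h : ess_le f g -> ess_le g h -> ess_le f h.
Proof.
move=> fg gh x y /fg[v /gh[w hx]].
by exists (v ++ w); rewrite !catA.
Qed.

Lemma ess_eq_restrictionP f g :
  ess_eq_restriction f g <-> restriction f g /\ ess_le g f.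
Proof.
split=> -[fg ess]; split=> //.
  (* Essentiality is tested on the principal right ideal generated by [x], which lies in [dom g]. *)
  move=> x y gx; have [|||z [[t ft] [w zw]]] := ess.2 [set z | exists w, z = x ++ w].
  - by move=> _ w [v ->]; exists (v ++ w); rewrite catA.
  - by exists x, [::]; rewrite cats0.
  - by move=> _ [v ->]; exists (y ++ v); apply: ri_cat.
  rewrite zw in ft; exists w; move: (fg _ _ ft).
  by rewrite (ri_cat w gx) ft.
split=> [x [y /fg gx]|S Sid [x Sx] SD]; first by exists y.
have [y /ess[w fx]] := SD _ Sx.
by exists (x ++ w); split; [exists (y ++ w) | apply: Sid].
Qed.

Lemma maxext_restriction f : restriction f (maxext f).
Proof. exact: (maxextP f).1.1. Qed.

Lemma maxext_ess_le f : ess_le (maxext f) f.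
Proof. by have /ess_eq_restrictionP[] := (maxextP f).1. Qed.

Lemma maxext_unique f g : is_max_ext f g -> maxext f = g.
Proof.
move=> fg; have [h [_ huniq]] := max_ext_exists_unique f.
by rewrite -(huniq _ fg) -(huniq _ (maxextP f)).
Qed.

(** [maxext g] is itself maximal over [f]: an essentially equal extension of [f] that extends
    [maxext g] is also one of [g]. *)
Lemma maxext_ess_eq_restriction f g :
  ess_eq_restriction f g -> maxext f = maxext g.
Proof.
move=> /ess_eq_restrictionP[fg gf]; apply: maxext_unique; split.
  apply/ess_eq_restrictionP; split=> [x y /fg|]; first exact: maxext_restriction.
  exact: ess_le_trans (@maxext_ess_le g) gf.
move=> h /ess_eq_restrictionP[_ hf] gh; apply: (maxextP g).2 => //.
apply/ess_eq_restrictionP; split=> [x y /maxext_restriction/gh //|].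
exact: ess_le_trans hf (restriction_ess_le fg).
Qed.

Lemma ess_le_agree f g x y z :
  ess_le f g -> f x = Some y -> g x = Some z -> y = z.
Proof.
move=> fg fx gx; have [w] := fg _ _ fx.
by rewrite (ri_cat w gx) => -[/catIr].
Qed.

(** By right cancellation [f] and [g] agree wherever both are defined. Their common restriction [h]
    is essential in each; writing it as a composite yields finite generation of its domain. *)
Lemma ess_le_maxext f g : ess_le f g -> ess_le g f -> maxext f = maxext g.
Proof.
move=> fg gf; pose h := Defs.comp f (id_on (ri_homP g).1 (ri_fin_gen g)).
have hP x y : h x = Some y <-> f x = Some y /\ g x = Some y.
  split=> [/compP[_ /id_funP[[z gx] ->] fx]|[fx gx]].
    by rewrite gx; split=> //; congr Some; rewrite (ess_le_agree fg fx gx).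
  by apply/compP; exists x => //; apply/id_funP; split=> //; exists y.
transitivity (maxext h).
  apply/esym/maxext_ess_eq_restriction/ess_eq_restrictionP.
  split=> [x y /hP[]//|x y fx]; have [w gx] := fg _ _ fx.
  by exists w; apply/hP; split=> //; apply: ri_cat.
apply/maxext_ess_eq_restriction/ess_eq_restrictionP.
split=> [x y /hP[]//|x y gx]; have [w fx] := gf _ _ gx.
by exists w; apply/hP; split=> //; apply: ri_cat.
Qed.

(* Cutting [y] at its shortest prefix in [im f], and choosing a preimage of
   that prefix only, makes the section of [f] commute with concatenation. *)
Lemma section_exists f : exists g,
  dom g = im f /\ forall x y, g y = Some x -> f x = Some y.
Proof.
(* The length of the shortest prefix of [y] in [im f]; the successor admits [y] itself as a
   prefix. *)
pose n y := find (fun i => `[< im f (take i y) >]) (iota 0 (size y).+1).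
have nhas y : im f y ->
    has (fun i => `[< im f (take i y) >]) (iota 0 (size y).+1).
  move=> fy; apply/hasP; exists (size y); first by rewrite mem_iota /= add0n.
  by apply/asboolP; rewrite take_size.
have nle y : im f y -> n y <= size y.
  by move=> /nhas; rewrite has_find size_iota ltnS.
have nim y : im f y -> im f (take (n y) y).
  move=> fy; have /(nth_find 0)/asboolP := nhas _ fy.
  by rewrite -/(n y) nth_iota ?ltnS ?nle.
have ncat y w : im f y -> n (y ++ w) = n y.
  (* The search succeeds among lengths at most [size y], where truncation does not see [w]. *)
  move=> fy; rewrite {1}/n size_cat -addSn iotaD find_cat.
  have e : {in iota 0 (size y).+1, forall i,
      `[< im f (take i (y ++ w)) >] = `[< im f (take i y) >]}.
    by move=> i; rewrite mem_iota /= add0n ltnS => iy; rewrite takel_cat.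
  by rewrite (eq_in_has e) nhas // (eq_in_find e).
pose pre p := if pselect (im f p) is left e then projT1 (cid e) else [::].
have preP p : im f p -> f (pre p) = Some p.
  by rewrite /pre; case: pselect => // e _; case: cid.
pose s y := if `[< im f y >]
            then Some (pre (take (n y) y) ++ drop (n y) y) else None.
have sP y : im f y -> s y = Some (pre (take (n y) y) ++ drop (n y) y).
  by rewrite /s; case: asboolP.
have dom_s : dom s = im f.
  apply/seteqP; split=> y; last by move=> /sP e; eexists; exact: e.
  by case=> x; rewrite /s; case: asboolP.
have s_hom : ri_hom s.
  split=> [|y x w sy]; first by rewrite dom_s; exact: right_ideal_im.
  have fy : im f y by rewrite -dom_s; exists x.
  move: sy; rewrite !sP //; last exact: right_ideal_im.
  move=> -[<-]; rewrite ncat // takel_cat ?nle // -catA; congr (Some (_ ++ _)).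
  (* [drop_cat] tests a strict inequality, so the case where the shortest prefix is all of [y] is
     separate. *)
  by rewrite drop_cat; have := nle _ fy; case: ltngtP => // ->;
    rewrite subnn drop0 drop_size.
have s_fg : fin_gen (dom s) by rewrite dom_s; exact: fin_gen_im.
exists (RiHom s_hom s_fg); split=> //= x y sy.
have fy : im f y by rewrite -dom_s; exists x.
move: sy; rewrite sP // => -[<-].
by rewrite (ri_cat _ (preP _ (nim _ fy))) cat_take_drop.
Qed.

Lemma maxext_sval (u : TH_monoid A) : maxext (sval u) = sval u.
Proof.
have [f ->] := svalP u.
by rewrite -(maxext_ess_eq_restriction (maxextP f).1).
Qed.

(** If [u] is the product of [v] and [s], each value of [u] extends to a value of the plain
    composite, hence of [v]. Conversely, with [g] a section of [v], the multiplier is [g] after [u]: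
    applying [v] to it gives back [u] wherever [u] lands in [im v], an essential part of its
    domain. *)
Lemma R_leP (u v : TH_monoid A) :
  R_le u v <-> forall y, im (sval u) y -> exists w, im (sval v) (y ++ w).
Proof.
split=> [[s ->] y [x /maxext_ess_le[w]]|uv].
  by move=> /compP[z _ vz]; exists w, z.
have [g [dom_g gP]] := section_exists (sval v).
pose s := TH_max (Defs.comp g (sval u)); exists s.
suff e : sval u = sval (TH_mul v s).
  exact: eq_sig_hprop (fun _ => @Prop_irrelevance _) _ _ e.
rewrite -maxext_sval; apply: ess_le_maxext => x y.
  move=> ux; have [|w vy] := uv y; first by exists x.
  have [z gz] : dom g (y ++ w) by rewrite dom_g.
  exists w; apply/compP; exists z; last exact: gP.
  apply: maxext_restriction; apply/compP.
  by exists (y ++ w) => //; apply: ri_cat.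
(* The multiplier may be defined at [x] only through [maxext]; extending [x] by [w] reaches the
   plain composite. *)
move=> /compP[z /maxext_ess_le[w /compP[t ux /gP vz]] vy].
by exists w; move: vz; rewrite (ri_cat w vy) => -[->].
Qed.

(** The maximal extension may have a larger image than [R], but not in a way that the criterion
    [R_leP] detects. *)
Lemma im_TH_id R (Rid : right_ideal R) (Rfg : fin_gen R) :
  let m := sval (TH_max (id_on Rid Rfg)) in
  R `<=` im m /\ forall y, im m y -> exists w, R (y ++ w).
Proof.
split=> [y Ry|y [x /maxext_ess_le[w /id_funP[Rx yx]]]].
  by exists y; apply: maxext_restriction; apply/id_funP.
by exists w; rewrite yx.
Qed.

End RightIdealHomomorphisms.

Theorem proposition4p4 (k : nat) (A : finType) (hk : 2 <= k) (hA : #|A| = k)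
    (phi psi : TH_monoid A) :
  R_gt phi psi -> exists chi : TH_monoid A, R_gt phi chi /\ R_gt chi psi.
Proof.
move=> [psi_phi ne]; have /R_leP le := psi_phi.
have {ne} nle : ~ R_le phi psi by move=> ?; apply: ne.
have [y [phiy ypsi]] : exists y, im (sval phi) y /\
    forall w, ~ im (sval psi) (y ++ w).
  apply: contrapT => /forallNP H; apply: nle; apply/R_leP => y phiy.
  by apply: contrapT => /forallNP ypsi; apply: (H y).
have /card_gt1P[a [b [_ _ ab]]] : 1 < #|A| by rewrite hA.
pose R := im (sval psi) `|` [set x | exists w, x = rcons y a ++ w].
have Rid : right_ideal R.
  move=> x w [/right_ideal_im px|[v ->]]; first by left.
  by right; exists (v ++ w); rewrite catA.
have Rfg : fin_gen R.
  apply: fin_gen_setU; first exact: fin_gen_im.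
  exists [:: rcons y a]; apply/seteqP; split=> x /=.
    by move=> xw; exists (rcons y a); rewrite ?mem_head.
  by case=> c; rewrite inE => /eqP ->.
have [Rchi chiR] := im_TH_id Rid Rfg.
set chi := TH_max _ in Rchi chiR; exists chi; split; split.
- apply/R_leP => x /chiR[w [/le[v]|[v xw]]].
    by rewrite -catA => phix; exists (w ++ v).
  by exists w; rewrite xw -cats1 -catA; apply: right_ideal_im.
(* An extension of [y b] in [R] would either put an extension of [y] in the image of [psi] or begin
   with [y a], forcing [a = b]. *)
- case=> _ /R_leP /(_ (rcons y b)) [|w /chiR[v]].
    by rewrite -cats1; apply: right_ideal_im.
  rewrite -!cats1 -!catA => -[/ypsi//|[u /eqP]].
  by rewrite -!cats1 -!catA eqseq_cat // eqxx /= => /eqP[ba]; rewrite ba eqxx in ab.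
- by apply/R_leP => x px; exists [::]; rewrite cats0; apply: Rchi; left.
- case=> _ /R_leP /(_ (rcons y a)) [|w].
    by apply: Rchi; right; exists [::]; rewrite cats0.
  by rewrite -cats1 -catA => /ypsi.
Qed.
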